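(* Let $C$ be a symmetric $n\times n$ matrix and let $\mathcal{X}\subset\mathbb{R}^n$ be an ellitope given by the representation $$\mathcal{X}=\{x\in\mathbb{R}^n:\ \exists(y\in\mathbb{R}^{\bar n},\,t\in\mathcal{T}):\ x=Py,\ y^TS_ky\le t_k,\ 1\le k\le K\}$$ (with $P$, $S_k$, $\mathcal{T}$ as in the context). Let $$\mathrm{Opt}_*=\max_{x\in\mathcal{X}}x^TCx,\qquad \mathrm{Opt}=\min_{\lambda\in\mathbb{R}^K}\Big\{\phi_{\mathcal{T}}(\lambda):\ \lambda\ge0,\ P^TCP\preceq\sum_{k=1}^K\lambda_kS_k\Big\}.$$ Then $$\frac{\mathrm{Opt}}{2\ln K+2\sqrt{\ln K}+1}\ \le\ \mathrm{Opt}_*\ \le\ \mathrm{Opt}.$$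
   Context: Ellitope data: $P$ is an $n\times\bar n$ matrix; $S_1,\dots,S_K$ are symmetric positive semidefinite $\bar n\times\bar n$ matrices with $\sum_kS_k\succ0$; $\mathcal{T}\subset\mathbb{R}^K_+$ is a nonempty convex compact set which intersects the interior of $\mathbb{R}^K_+$ and is monotone ($0\le\tau\le t$ and $t\in\mathcal{T}$ imply $\tau\in\mathcal{T}$). $\phi_{\mathcal{T}}(\lambda)=\max_{t\in\mathcal{T}}\lambda^Tt$ is the support function of $\mathcal{T}$. *)

(* Defs.v *)
From HB Require Import structures.
From mathcomp Require Import all_boot all_order all_algebra.
From mathcomp Require Import all_classical all_reals all_analysis.

Set Implicit Arguments.
Unset Strict Implicit.
Unset Printing Implicit Defensive.

Import Order.TTheory GRing.Theory Num.Theory.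
Import numFieldNormedType.Exports.

Local Open Scope classical_set_scope.
Local Open Scope ring_scope.

Section definitions.
Context {R : realType}.

Definition is_max (A : set R) (m : R) : Prop := A m /\ ubound A m.
Definition is_min (A : set R) (m : R) : Prop := A m /\ lbound A m.

Definition dotprod m (u v : 'cV[R]_m) : R := (u^T *m v) 0 0.
Definition qform m (A : 'M[R]_m) (x : 'cV[R]_m) : R := (x^T *m A *m x) 0 0.

Definition psdmx m (A : 'M[R]_m) : Prop :=
  A^T = A /\ forall x : 'cV[R]_m, 0 <= qform A x.

Definition pdmx m (A : 'M[R]_m) : Prop :=
  A^T = A /\ forall x : 'cV[R]_m, x != 0 -> 0 < qform A x.

(* The Loewner order. *)
Definition lemx m (A B : 'M[R]_m) : Prop := psdmx (B - A).

Definition orthant K : set 'cV[R]_K := [set t | forall k, 0 <= t k 0].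

Definition monotone_set K (T : set 'cV[R]_K) : Prop :=
  forall tau t : 'cV[R]_K, T t ->
    (forall k, 0 <= tau k 0 /\ tau k 0 <= t k 0) -> T tau.

Record ellitope_data nbar K (S : 'I_K -> 'M[R]_nbar) (T : set 'cV[R]_K)
    : Prop := EllitopeData {
  ell_psd : forall k, psdmx (S k);
  ell_pd : pdmx (\sum_k S k);
  ell_orthant : T `<=` @orthant K;
  ell_nonempty : T !=set0;
  ell_convex : @convex_set R 'cV[R]_K T;
  ell_compact : compact T;
  ell_interior : (T `&` (@orthant K)°) !=set0;
  ell_monotone : monotone_set T }.

Definition ellitope n nbar K (P : 'M[R]_(n, nbar)) (S : 'I_K -> 'M[R]_nbar)
    (T : set 'cV[R]_K) : set 'cV[R]_n :=
  [set x | exists (y : 'cV[R]_nbar) (t : 'cV[R]_K),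
    [/\ T t, x = P *m y & forall k, qform (S k) y <= t k 0]].

(* The supremum is a maximum when T is nonempty and compact: support_fun_max. *)
Definition support_fun K (T : set 'cV[R]_K) (lambda : 'cV[R]_K) : R :=
  sup [set dotprod lambda t | t in T].

Definition primal_values n nbar K (C : 'M[R]_n) (P : 'M[R]_(n, nbar))
    (S : 'I_K -> 'M[R]_nbar) (T : set 'cV[R]_K) : set R :=
  [set qform C x | x in ellitope P S T].

Definition relax_feasible n nbar K (C : 'M[R]_n) (P : 'M[R]_(n, nbar))
    (S : 'I_K -> 'M[R]_nbar) : set 'cV[R]_K :=
  [set lambda | (forall k, 0 <= lambda k 0) /\
                lemx (P^T *m C *m P) (\sum_k lambda k 0 *: S k)].

Definition relax_values n nbar K (C : 'M[R]_n) (P : 'M[R]_(n, nbar))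
    (S : 'I_K -> 'M[R]_nbar) (T : set 'cV[R]_K) : set R :=
  [set support_fun T lambda | lambda in relax_feasible C P S].

Definition Opt_star n nbar K (C : 'M[R]_n) (P : 'M[R]_(n, nbar))
    (S : 'I_K -> 'M[R]_nbar) (T : set 'cV[R]_K) : R :=
  sup (primal_values C P S T).

Definition Opt n nbar K (C : 'M[R]_n) (P : 'M[R]_(n, nbar))
    (S : 'I_K -> 'M[R]_nbar) (T : set 'cV[R]_K) : R :=
  inf (relax_values C P S T).

Lemma support_fun_max K (T : set 'cV[R]_K) (lambda : 'cV[R]_K) :
  T !=set0 -> compact T ->
  is_max [set dotprod lambda t | t in T] (support_fun T lambda).
Proof.
move=> T0 cT; have cdot : continuous (dotprod lambda : 'cV[R]_K -> R).
  move=> t; rewrite /continuous_at /dotprod mxE.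
  under eq_fun do rewrite mxE.
  have Ft := nbhs_filter t.
  apply: (cvg_big (op := +%R)) => [|k _].
    exact: add_continuous.
  by apply: cvgM; [exact: cvg_cst | exact: coord_continuous].
have [c cT' cmax] :=
  compact_EVT_max T0 cT (continuous_subspaceT cdot).
have ub : ubound [set dotprod lambda t | t in T] (dotprod lambda c).
  by move=> _ [t Tt <-]; apply: cmax; rewrite inE.
have Ac : [set dotprod lambda t | t in T] (dotprod lambda c).
  by exists c => //; rewrite inE in cT'.
rewrite /support_fun (_ : sup _ = dotprod lambda c); first by split.
apply/eqP; rewrite eq_le; apply/andP; split.
  by apply: ge_sup => //; exists (dotprod lambda c).
by apply: ub_le_sup => //; exists (dotprod lambda c).
Qed.

End definitions.

(* Main.v *)
(* Write Q = P^T C P. Separating convex sets gives the dual of the relaxation: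
   every r < Opt is at most tr(V^T Q V) for some matrix V and some t in T with
   tr(V^T S_k V) <= t_k for all k. Let U be orthogonal and diagonalize V^T Q V.
   For every vector e of signs, y = V U e satisfies y^T Q y = tr(V^T Q V), while
   y^T S_k y is on average tr(V^T S_k V). For a unit vector a and random signs e,
   E exp(th (a.e)^2) <= (1 - 2 th)^(-1/2), as for a Gaussian; by Jensen's
   inequality this passes to the forms y^T S_k y normalized by tr(V^T S_k V).
   With th = u / (1 + 2u), some e then satisfies, for all k at once,
   y^T S_k y <= (1 + 2 ln K + ln K / u + u) t_k. Rescaling y yields a point of the
   ellitope; take u = sqrt (ln K), or let u tend to 0 when K = 1. *)
Require Import Defs.
From HB Require Import structures.
From mathcomp Require Import all_boot all_order all_algebra.
From mathcomp Require Import all_classical all_reals all_analysis.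
From mathcomp Require Import ring lra.

Set Implicit Arguments.
Unset Strict Implicit.
Unset Printing Implicit Defensive.

Import Order.TTheory GRing.Theory Num.Theory.
Import numFieldNormedType.Exports.

Local Open Scope classical_set_scope.
Local Open Scope ring_scope.

(** * Exponential inequalities *)

Section ExponentialInequalities.
Variable R : realType.
Implicit Types x u : R.

Lemma ge0_is_derive_le (f df : R -> R) x :
  (forall y : R, is_derive y 1 f (df y)) -> (forall y, 0 < y -> 0 <= df y) ->
  0 <= x -> f 0 <= f x.
Proof.
move=> dfE df0 x0.
have dv (y : R) : derivable f y 1 by case: (dfE y).
apply: (@ger0_derive1_ndecry _ f 0) => // [y|].
  by rewrite in_itv/= andbT => y0; rewrite derive1E derive_val df0.
apply: continuous_subspaceT => y.
by apply: differentiable_continuous; apply/derivable1_diffP.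
Qed.

Lemma is_derive_expRN x : is_derive x 1 (fun y : R => expR (- y)) (- expR (- x)).
Proof.
rewrite -[fun _ => _]/(expR \o -%R).
by apply: is_derive_eq; rewrite mulrN1.
Qed.

(** The difference of the two sides has the derivative [(expR (y / 2) - expR (- (y / 2))) ^+ 2]. The
    case [x = ln (1 + 2 * u)] yields [sqrt_le_expR]. *)
Lemma two_mul_le_expRB x : 0 <= x -> 2 * x <= expR x - expR (- x).
Proof.
move=> x0; rewrite -subr_ge0.
have := @ge0_is_derive_le (fun y => expR y - expR (- y) - 2 * y)
  (fun y => expR y + expR (- y) - 2) x.
rewrite oppr0 expR0 mulr0 !subr0 subrr; apply=> // [y|y _].
  have d1 := is_derive_expRN y.
  have d2 : is_derive y 1 (fun z => 2 * z) (2 : R).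
    rewrite -[fun _ => _]/((2 : R) \*: (@id R)).
    by apply: is_derive_eq; rewrite /GRing.scale/= mulr1.
  by apply: is_derive_eq; rewrite opprK.
have : 0 <= (expR (y / 2) - expR (- (y / 2))) ^+ 2 by rewrite sqr_ge0.
have e1 : expR (y / 2) * expR (- (y / 2)) = 1 by rewrite expRN divff// gt_eqF ?expR_gt0.
have -> : expR y = expR (y / 2) * expR (y / 2) by rewrite -expRD -splitr.
have -> : expR (- y) = expR (- (y / 2)) * expR (- (y / 2)).
  by rewrite -expRD -opprD -splitr.
move: e1; set a := expR _; set b := expR _ => e1.
by nra.
Qed.

(** That is, tanh x <= x, which gives the sign of the derivative in [expRD_le_gauss]. *)
Lemma expRB_le_mulD x : 0 <= x ->
  expR x - expR (- x) <= x * (expR x + expR (- x)).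
Proof.
move=> x0; rewrite -subr_ge0.
have := @ge0_is_derive_le
  (fun y => y * (expR y + expR (- y)) - (expR y - expR (- y)))
  (fun y => y * (expR y - expR (- y))) x.
rewrite oppr0 expR0 mul0r !subrr; apply=> // [y|y y0].
  have d1 := is_derive_expRN y.
  by apply: is_derive_eq; rewrite /GRing.scale/=; ring.
rewrite mulr_ge0 ?ltW// subr_gt0 ltr_expR; lra.
Qed.

(** Both sides are even, and for x >= 0 the function 2 cosh x exp(-x^2/2) is nonincreasing because
    tanh x <= x. *)
Lemma expRD_le_gauss x : expR x + expR (- x) <= 2 * expR (x ^+ 2 / 2).
Proof.
wlog x0 : x / 0 <= x => [hw|].
  have [x0|/ltW x0] := leP 0 x; first exact: hw.
  by have := hw (- x); rewrite opprK sqrrN addrC oppr_ge0; apply.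
have := @ge0_is_derive_le
  (fun y => - ((expR y + expR (- y)) * expR (- (y ^+ 2 / 2))))
  (fun y => (y * (expR y + expR (- y)) - (expR y - expR (- y))) *
            expR (- (y ^+ 2 / 2))) x.
rewrite oppr0 expR0 expr0n/= mul0r oppr0 expR0 mulr1 lerN2.
move=> h; rewrite -ler_pdivrMr ?expR_gt0// -expRN; apply: h => // [y|y y0].
  have d1 := is_derive_expRN y.
  have d2 : is_derive y 1 (fun z : R => expR (- (z ^+ 2 / 2)))
      (- y * expR (- (y ^+ 2 / 2))).
    rewrite -[fun _ => _]/(expR \o (- (fun z : R => z ^+ 2 / 2))).
    have d3 : is_derive y 1 (fun z : R => z ^+ 2 / 2) y.
      rewrite -[fun _ => _]/((fun z : R => z ^+ 2) * cst (2^-1 : R)).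
      by apply: is_derive_eq; rewrite /GRing.scale/= /cst/=; field.
    by apply: is_derive_eq; rewrite mulrC.
  by apply: is_derive_eq; rewrite /GRing.scale/=; ring.
by rewrite mulr_ge0 ?expR_ge0// subr_ge0 expRB_le_mulD// ltW.
Qed.

End ExponentialInequalities.

(** * Choice of signs *)

Section Signs.
Variable R : realType.
Implicit Types a v p theta : R.

(** With a standard Gaussian in place of the random sign of [v], the averages would be equal. The
    shape of the expression is therefore stable: averaging out one sign only lowers [p] by
    [2 * theta * v ^+ 2]. *)
Lemma rademacher_step theta p a v : 0 <= theta -> 0 < p - 2 * theta * v ^+ 2 ->
  (Num.sqrt p)^-1 * expR (theta * (a + v) ^+ 2 / p) +
  (Num.sqrt p)^-1 * expR (theta * (a - v) ^+ 2 / p) <=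
  2 * ((Num.sqrt (p - 2 * theta * v ^+ 2))^-1 *
       expR (theta * a ^+ 2 / (p - 2 * theta * v ^+ 2))).
Proof.
set q := p - _ => t0 q0.
have tv0 : 0 <= 2 * theta * v ^+ 2 by rewrite (mulr_ge0 (mulr_ge0 _ _) (sqr_ge0 _)).
have p0 : 0 < p by rewrite (lt_le_trans q0)// /q gerBl.
set s := 2 * theta * v ^+ 2 / p.
have s0 : 0 <= s by rewrite divr_ge0// ltW.
have qE : q = p * (1 - s) by rewrite /q /s; field; rewrite gt_eqF.
have s1 : 0 < 1 - s by move: q0; rewrite qE pmulr_rgt0.
pose b := theta * a ^+ 2 / p; pose x := 2 * theta * a * v / p.
have b0 : 0 <= b by rewrite divr_ge0 ?(ltW p0)// (mulr_ge0 t0 (sqr_ge0 _)).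
have -> : theta * (a + v) ^+ 2 / p = b + s / 2 + x.
  by rewrite /b /s /x; field; rewrite gt_eqF.
have -> : theta * (a - v) ^+ 2 / p = b + s / 2 - x.
  by rewrite /b /s /x; field; rewrite gt_eqF.
rewrite -mulrDr !(expRD (b + _)) -mulrDr.
(* The left side is now p^(-1/2) e^(b + s/2) (e^x + e^(-x)). The factor e^(s/2) is absorbed by 1 - s
   <= e^(-s), and the bound e^(x^2/2) on cosh x by b + b s <= b / (1 - s). *)
have sq : (Num.sqrt p)^-1 * expR (s / 2) <= (Num.sqrt q)^-1.
  rewrite qE sqrtrM ?(ltW p0)// invfM ler_wpM2l ?invr_ge0 ?sqrtr_ge0//.
  rewrite -[leLHS]invrK -expRN lef_pV2 ?posrE ?expR_gt0 ?sqrtr_gt0//.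
  rewrite -(@ler_pXn2r _ 2) ?nnegrE ?expR_ge0 ?sqrtr_ge0// sqr_sqrtr ?(ltW s1)//.
  by rewrite -expRM_natl mulrN mulrC divfK// expR_ge1Dx.
have ex : expR b * expR (x ^+ 2 / 2) <= expR (theta * a ^+ 2 / q).
  rewrite -expRD ler_expR.
  have -> : x ^+ 2 / 2 = b * s by rewrite /x /b /s; field; rewrite gt_eqF.
  have -> : theta * a ^+ 2 / q = b / (1 - s).
    by rewrite qE /b; field; rewrite !gt_eqF.
  by rewrite ler_pdivlMr//; nra.
have gx := expRD_le_gauss x; move: gx ex.
set y := x ^+ 2 / 2; clearbody y s b x => gx ex.
apply: (@le_trans _ _ ((Num.sqrt p)^-1 * expR (s / 2) *
    (2 * (expR b * expR y)))).
  rewrite expRD -!mulrA ler_wpM2l ?invr_ge0 ?sqrtr_ge0// mulrCA.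
  by rewrite ler_wpM2l ?expR_ge0// mulrCA ler_wpM2l ?expR_ge0//.
rewrite mulrCA ler_wpM2l// ler_pM ?mulr_ge0 ?invr_ge0 ?sqrtr_ge0 ?expR_ge0//.
Qed.

(* Greedy choice of the signs: the right-hand side, computed for the
   coordinates not yet fixed, is a potential that one of the two choices does
   not increase. *)
Lemma exists_signs_expR_le (J : finType) (w : J -> R) theta N
    (a : J -> R) (u : J -> 'I_N -> R) :
  (forall j, 0 <= w j) -> 0 <= theta ->
  (forall j, 0 < 1 - 2 * theta * \sum_i u j i ^+ 2) ->
  exists2 e : 'I_N -> R, forall i, e i ^+ 2 = 1 &
    \sum_j w j * expR (theta * (a j + \sum_i u j i * e i) ^+ 2) <=
    \sum_j w j * ((Num.sqrt (1 - 2 * theta * \sum_i u j i ^+ 2))^-1 *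
      expR (theta * a j ^+ 2 / (1 - 2 * theta * \sum_i u j i ^+ 2))).
Proof.
move=> w0 t0; elim: N a u => [|N IH] a u u1.
  exists (fun=> 1) => [[]//|]; apply: ler_sum => j _.
  by rewrite !big_ord0 mulr0 subr0 addr0 sqrtr1 invr1 mul1r mulr1.
pose p j := 1 - 2 * theta * \sum_i u j (lift ord0 i) ^+ 2.
pose F s := \sum_j w j * ((Num.sqrt (p j))^-1 *
  expR (theta * (a j + u j ord0 * s) ^+ 2 / p j)).
have pE j : 1 - 2 * theta * \sum_i u j i ^+ 2 =
    p j - 2 * theta * u j ord0 ^+ 2.
  by rewrite big_ord_recl /p; ring.
have [s s1 Fs] : exists2 s, s ^+ 2 = 1 & F s <=
    \sum_j w j * ((Num.sqrt (1 - 2 * theta * \sum_i u j i ^+ 2))^-1 *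
      expR (theta * a j ^+ 2 / (1 - 2 * theta * \sum_i u j i ^+ 2))).
  set B := \sum_j _.
  have FB : F 1 + F (-1) <= 2 * B.
    rewrite mulr_sumr -big_split/=; apply: ler_sum => j _.
    rewrite -mulrDr [leRHS]mulrCA ler_wpM2l// mulr1 mulrN1 pE.
    by apply: rademacher_step; rewrite // -pE.
  have [F1|F1] := leP (F 1) B; first by exists 1 => //; rewrite expr1n.
  by exists (-1); [rewrite sqrrN expr1n | lra].
(* The coordinate whose sign is fixed moves into the shift [a]. *)
have [|e e1 He] := IH (fun j => a j + u j ord0 * s) (fun j i => u j (lift ord0 i)).
  move=> j; apply: (lt_le_trans (u1 j)); rewrite pE gerBl.
  by rewrite (mulr_ge0 (mulr_ge0 _ _) (sqr_ge0 _)).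
exists (fun i => oapp e s (unlift ord0 i)) => [i|].
  by case: unliftP => [j _|_] /=.
apply: le_trans Fs; apply: le_trans He; apply: ler_sum => j _.
rewrite big_ord_recl unlift_none/= addrA.
by under eq_bigr do rewrite liftK.
Qed.

(** Convexity enters through the tangent at the mean [z]: e^x >= e^z (1 + x - z). *)
Lemma expR_jensen (L : finType) (m x : L -> R) :
  (forall l, 0 <= m l) -> \sum_l m l = 1 ->
  expR (\sum_l m l * x l) <= \sum_l m l * expR (x l).
Proof.
move=> m0 m1; set z := \sum_l _.
have : \sum_l m l * (expR z * (1 + (x l - z))) <= \sum_l m l * expR (x l).
  apply: ler_sum => l _; rewrite ler_wpM2l//.
  rewrite -[in leRHS](subrKC z (x l)) expRD ler_wpM2l ?expR_ge0//.
  exact: expR_ge1Dx.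
apply: le_trans.
under eq_bigr do rewrite mulrCA.
rewrite -mulr_sumr -[leLHS]mulr1 ler_wpM2l ?expR_ge0//.
rewrite (eq_bigr (fun l => m l * (1 - z) + m l * x l)) => [|l _]; last by ring.
by rewrite big_split/= -mulr_suml m1 mul1r -/z subrK.
Qed.

End Signs.

(** * Topology of column vectors *)

Section MatrixTopology.
Variable R : realType.

Lemma continuous_mx (T : topologicalType) m n (f : T -> 'M[R]_(m, n)) :
  (forall i j, continuous (fun x => f x i j)) -> continuous f.
Proof.
move=> fc x A [P fP PA]; have Fx := nbhs_filter x.
have /filterS : nbhs x [set y | forall i j, P i j (f y i j)].
  apply: (filter_forall (F := nbhs x)) => i.
  by apply: (filter_forall (F := nbhs x)) => j; exact: (fc i j x _ (fP i j)).
by apply=> y Py; exact: PA.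
Qed.

Lemma continuous_sum (T : topologicalType) (I : finType) (f : I -> T -> R) :
  (forall i, continuous (f i)) -> continuous (fun x => \sum_i f i x).
Proof.
move=> fc x; rewrite /continuous_at.
have Fx := nbhs_filter x.
apply: (cvg_big (op := +%R)) => [|i _]; first exact: add_continuous.
exact: fc.
Qed.

Lemma dotprodE n (u v : 'cV[R]_n) : dotprod u v = \sum_i u i 0 * v i 0.
Proof. by rewrite /dotprod mxE; apply: eq_bigr => i _; rewrite mxE. Qed.

Lemma qformE n (A : 'M[R]_n) (x : 'cV[R]_n) :
  qform A x = \sum_i \sum_j A i j * (x i 0 * x j 0).
Proof.
rewrite /qform -mulmxA mxE; apply: eq_bigr => i _.
rewrite !mxE mulr_sumr; apply: eq_bigr => j _; ring.
Qed.

Lemma continuous_qform n (A : 'M[R]_n) : continuous (qform A).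
Proof.
rewrite (_ : qform A = fun x => \sum_i \sum_j A i j * (x i 0 * x j 0)); last first.
  by apply/funext => x; rewrite qformE.
apply: continuous_sum => i; apply: continuous_sum => j x.
have Fx := nbhs_filter x; apply: cvgM; first exact: cvg_cst.
by apply: cvgM; exact: coord_continuous.
Qed.

(** Boxes of row vectors are compact, and transposition carries them continuously to column
    vectors. *)
Lemma bounded_closed_compact_cV n (A : set 'cV[R]_n) M :
  closed A -> (forall x, A x -> forall i, `|x i 0| <= M) -> compact A.
Proof.
move=> clA bA.
have := @rV_compact _ n (fun=> `[- M, M]%classic)
  (fun=> @segment_compact R (- M) M).
set B := [set _ | _] => cB.
have ct : continuous (trmx : 'rV[R]_n -> 'cV[R]_n).
  apply: continuous_mx => i j.
  rewrite (_ : (fun x => _) = fun x : 'rV[R]_n => x j i); last first.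
    by apply/funext => x; rewrite mxE.
  exact: coord_continuous.
have cB' := continuous_compact (continuous_subspaceT ct) cB.
apply: (subclosed_compact clA cB') => x Ax; exists x^T; last by rewrite trmxK.
by move=> i /=; rewrite mxE in_itv/= -ler_norml bA.
Qed.

Lemma closed_le_preimage (T : topologicalType) (f g : T -> R) :
  continuous f -> continuous g -> closed [set x | f x <= g x].
Proof.
move=> fc gc.
rewrite (_ : [set _ | _] = (fun x => f x - g x) @^-1` [set y | y <= 0]); last first.
  by apply/seteqP; split => x /=; rewrite subr_le0.
apply: (continuous_closedP _).1; last exact: closed_le.
by move=> x; have Fx := nbhs_filter x; apply: cvgB; [exact: fc|exact: gc].
Qed.

Lemma compact_closed_cV n (A : set 'cV[R]_n) : compact A -> closed A.
Proof. by apply: compact_closed; exact: norm_hausdorff. Qed.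

End MatrixTopology.

(** * Quadratic forms and the spectral theorem *)

Section QuadraticForms.
Variable R : realType.

Lemma dotprodC n (u v : 'cV[R]_n) : dotprod u v = dotprod v u.
Proof. by rewrite !dotprodE; apply: eq_bigr => i _; rewrite mulrC. Qed.

Lemma dotprodDr n (u v w : 'cV[R]_n) :
  dotprod u (v + w) = dotprod u v + dotprod u w.
Proof. by rewrite /dotprod mulmxDr mxE. Qed.

Lemma dotprodZr n (u v : 'cV[R]_n) a : dotprod u (a *: v) = a * dotprod u v.
Proof. by rewrite /dotprod -scalemxAr mxE. Qed.

Lemma dotprodBr n (u v w : 'cV[R]_n) :
  dotprod u (v - w) = dotprod u v - dotprod u w.
Proof. by rewrite -scaleN1r dotprodDr dotprodZr mulN1r. Qed.

Lemma dotprod_ge0 n (u : 'cV[R]_n) : 0 <= dotprod u u.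
Proof. by rewrite dotprodE sumr_ge0// => i _; rewrite -expr2 sqr_ge0. Qed.

Lemma sqr_coord_le_dotprod n (u : 'cV[R]_n) i : u i 0 ^+ 2 <= dotprod u u.
Proof.
rewrite dotprodE (bigD1 i)//= -expr2 lerDl sumr_ge0// => j _.
by rewrite -expr2 sqr_ge0.
Qed.

Lemma dotprod_eq0 n (u : 'cV[R]_n) : dotprod u u = 0 -> u = 0.
Proof.
move=> u0; apply/colP => i; rewrite mxE; apply/eqP; rewrite -sqrf_eq0.
by rewrite eq_le sqr_ge0 -u0 sqr_coord_le_dotprod.
Qed.

Lemma qform_dotprod n (A : 'M[R]_n) x : qform A x = dotprod x (A *m x).
Proof. by rewrite /qform /dotprod mulmxA. Qed.

Lemma qform1 n (x : 'cV[R]_n) : qform 1%:M x = dotprod x x.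
Proof. by rewrite qform_dotprod mul1mx. Qed.

Lemma qformZ n (A : 'M[R]_n) a x : qform A (a *: x) = a ^+ 2 * qform A x.
Proof.
rewrite !qform_dotprod -scalemxAr dotprodZr dotprodC dotprodZr dotprodC.
by rewrite mulrA expr2.
Qed.

Lemma qformDl n (A B : 'M[R]_n) x : qform (A + B) x = qform A x + qform B x.
Proof. by rewrite /qform mulmxDr mulmxDl mxE. Qed.

Lemma qformZl n (A : 'M[R]_n) a x : qform (a *: A) x = a * qform A x.
Proof. by rewrite /qform -scalemxAr -scalemxAl mxE. Qed.

Lemma qformNl n (A : 'M[R]_n) x : qform (- A) x = - qform A x.
Proof. by rewrite -scaleN1r qformZl mulN1r. Qed.

Lemma qformBl n (A B : 'M[R]_n) x : qform (A - B) x = qform A x - qform B x.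
Proof. by rewrite qformDl qformNl. Qed.

Lemma qform_suml n (I : finType) (A : I -> 'M[R]_n) x :
  qform (\sum_i A i) x = \sum_i qform (A i) x.
Proof. by rewrite /qform mulmx_sumr mulmx_suml summxE. Qed.

Lemma qform_mulmx n m (A : 'M[R]_n) (P : 'M[R]_(n, m)) x :
  qform A (P *m x) = qform (P^T *m A *m P) x.
Proof. by rewrite /qform trmx_mul !mulmxA. Qed.

Lemma dotprod_mulmx_sym n (A : 'M[R]_n) x y : A^T = A ->
  dotprod x (A *m y) = dotprod y (A *m x).
Proof.
by move=> sA; rewrite dotprodC /dotprod trmx_mul sA mulmxA.
Qed.

Lemma qform_addZ n (A : 'M[R]_n) x y s : A^T = A ->
  qform A (x + s *: y) =
  qform A x + 2 * s * dotprod y (A *m x) + s ^+ 2 * qform A y.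
Proof.
move=> sA; rewrite !qform_dotprod mulmxDr -scalemxAr !dotprodDr !dotprodZr.
rewrite ![dotprod (x + _) _]dotprodC !dotprodDr !dotprodZr.
rewrite ![dotprod (_ *m _) _]dotprodC (dotprod_mulmx_sym x y sA); ring.
Qed.

(** The quadratic attains its minimum 0 at [s = 0]. The test point is [- b] if [c <= 0], and the
    vertex [- b / c] otherwise. *)
Lemma quadratic_ge0_coef0 (b c : R) :
  (forall s, 0 <= 2 * s * b + s ^+ 2 * c) -> b = 0.
Proof.
move=> h; have [c0|c0] := leP c 0.
  have := h (- b); have := sqr_ge0 b.
  by move=> b2 hb; apply/eqP; rewrite -sqrf_eq0 eq_le b2 andbT; nra.
have := h (- b / c).
rewrite (_ : _ + _ = - (b ^+ 2 / c)); last by field; rewrite gt_eqF.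
rewrite oppr_ge0 pmulr_lle0 ?invr_gt0// => b2.
by apply/eqP; rewrite -sqrf_eq0 eq_le b2 sqr_ge0.
Qed.

(** Along the line v + s (A v) the form is a nonnegative quadratic in [s] without constant term,
    whose linear coefficient is 2 |A v|^2. *)
Lemma psdmx_qform_eq0 n (A : 'M[R]_n) v : psdmx A -> qform A v = 0 -> A *m v = 0.
Proof.
move=> [sA A0] v0; apply: dotprod_eq0.
apply: (@quadratic_ge0_coef0 _ (qform A (A *m v))) => s.
by have := A0 (v + s *: (A *m v)); rewrite qform_addZ// v0 add0r.
Qed.

Lemma unit_sphere_compact n : compact [set x : 'cV[R]_n | dotprod x x = 1].
Proof.
apply: (@bounded_closed_compact_cV _ _ _ 1) => [|x /= x1 i].
  have cd : continuous (fun x : 'cV[R]_n => dotprod x x).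
    rewrite (_ : (fun x => _) = qform 1%:M); first exact: continuous_qform.
    by apply/funext => x; rewrite qform1.
  have c1 : continuous (fun _ : 'cV[R]_n => (1 : R)) by move=> x; exact: cst_continuous.
  rewrite (_ : [set _ | _] = [set x : 'cV[R]_n | dotprod x x <= 1] `&`
      [set x : 'cV[R]_n | 1 <= dotprod x x]).
    by apply: closedI; exact: closed_le_preimage.
  apply/seteqP; split => x /= => [->//|[x1 x1']].
  by apply/eqP; rewrite eq_le x1.
by rewrite -(@expr_le1 _ 2)// real_normK ?num_real// -x1 sqr_coord_le_dotprod.
Qed.

Lemma rayleigh_max n (A : 'M[R]_n.+1) : exists2 v : 'cV[R]_n.+1,
  dotprod v v = 1 & forall x, qform A x <= qform A v * dotprod x x.
Proof.
have e0 : [set x : 'cV[R]_n.+1 | dotprod x x = 1] !=set0.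
  exists (delta_mx ord0 0); rewrite /= dotprodE (bigD1 ord0)//= !mxE !eqxx mulr1.
  by rewrite big1 ?addr0// => i i0; rewrite mxE (negbTE i0) mul0r.
have [v] := compact_EVT_max e0 (@unit_sphere_compact _)
  (continuous_subspaceT (@continuous_qform _ _ A)).
rewrite inE/= => v1 vmax; exists v => // x.
have [x0|x0] := eqVneq (dotprod x x) 0.
  by rewrite (dotprod_eq0 x0) -(scale0r 0) qformZ expr0n/= mul0r dotprodZr mul0r mulr0.
have xp : 0 < dotprod x x by rewrite lt_neqAle eq_sym x0 dotprod_ge0.
have := vmax ((Num.sqrt (dotprod x x))^-1 *: x); rewrite inE/= qformZ exprVn.
rewrite sqr_sqrtr ?dotprod_ge0// mulrC ler_pdivrMr//; apply.
rewrite dotprodZr dotprodC dotprodZr mulrA -expr2 exprVn sqr_sqrtr ?dotprod_ge0//.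
by rewrite mulVf.
Qed.

(** With l the maximal value, l I - A is positive semidefinite and its form vanishes at [v], so it
    annihilates [v]. *)
Lemma rayleigh_eigenvector n (A : 'M[R]_n.+1) v : A^T = A -> dotprod v v = 1 ->
  (forall x, qform A x <= qform A v * dotprod x x) -> A *m v = qform A v *: v.
Proof.
move=> sA v1 vmax; apply/eqP; rewrite eq_sym -subr_eq0 -mul_scalar_mx -mulmxBl.
apply/eqP/psdmx_qform_eq0.
  split; first by rewrite linearB/= tr_scalar_mx sA.
  by move=> x; rewrite qformBl -scalemx1 qformZl qform1 subr_ge0.
by rewrite qformBl -scalemx1 qformZl qform1 v1 mulr1 subrr.
Qed.

Lemma qform_ub n (A : 'M[R]_n) :
  exists2 M, 0 <= M & forall x, qform A x <= M * dotprod x x.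
Proof.
case: n A => [|n] A.
  by exists 0 => // x; rewrite (flatmx0 x) /qform mulmx0 mxE mul0r.
have [v _ vmax] := rayleigh_max A.
(* Clipping at 0 keeps the constant nonnegative even when [A] is negative definite. *)
exists (Num.max 0 (qform A v)) => [|x]; first by rewrite le_max lexx.
by rewrite (le_trans (vmax x))// ler_wpM2r ?dotprod_ge0// le_max lexx orbT.
Qed.

Lemma pdmx_qform_lb n (A : 'M[R]_n) : pdmx A ->
  exists2 c, 0 < c & forall x, c * dotprod x x <= qform A x.
Proof.
case: n A => [|n] A [sA A0].
  by exists 1 => // x; rewrite (flatmx0 x) /qform /dotprod !mulmx0 mxE mulr0.
have [v v1 vmax] := rayleigh_max (- A).
exists (qform A v) => [|x]; last first.
  by have := vmax x; rewrite !qformNl mulNr lerN2.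
apply: A0; apply/eqP => v0; move: v1.
by rewrite v0 /dotprod mulmx0 mxE => /esym/eqP; rewrite oner_eq0.
Qed.

Lemma mul_tr_scalar n (w : 'cV[R]_n) : w^T *m w = (dotprod w w)%:M.
Proof. exact: mx11_scalar. Qed.

(** The reflection in the hyperplane orthogonal to v - u exchanges the two vectors of equal
    length. *)
Lemma householder n (u v : 'cV[R]_n) : dotprod u u = dotprod v v ->
  exists H : 'M[R]_n, [/\ H^T = H, H *m H = 1%:M & H *m u = v].
Proof.
move=> uv; have [->|neq] := eqVneq u v.
  by exists 1%:M; rewrite trmx1 !mul1mx.
pose w := v - u.
have w0 : dotprod w w != 0.
  by apply: contra neq => /eqP/dotprod_eq0/eqP; rewrite subr_eq0 eq_sym.
pose b := 2 / dotprod w w; exists (1%:M - b *: (w *m w^T)); split.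
- by rewrite linearB/= trmx1 linearZ/= trmx_mul trmxK.
- have : (w *m w^T) *m (w *m w^T) = dotprod w w *: (w *m w^T).
    by rewrite mulmxA -[w *m w^T *m w]mulmxA mul_tr_scalar mul_mx_scalar -scalemxAl.
  move: (w *m w^T) => P PP; rewrite mulmxBl mul1mx mulmxBr mulmx1.
  rewrite -scalemxAl -scalemxAr PP !scalerA.
  rewrite (_ : b * b * dotprod w w = b + b); last by rewrite /b; field.
  by rewrite scalerDl opprB addrK subrK.
- rewrite mulmxBl mul1mx -scalemxAl -mulmxA.
  (* Equality of the lengths makes w^T u equal to - |w|^2 / 2. *)
  have -> : w^T *m u = (- b^-1)%:M.
    rewrite [LHS]mx11_scalar; congr (_%:M).
    have wu : dotprod w u = dotprod v u - dotprod u u.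
      by rewrite dotprodC dotprodBr dotprodC.
    have ww : dotprod w w = 2 * dotprod u u - 2 * dotprod v u.
      rewrite {2}/w dotprodBr wu dotprodC dotprodBr -uv (dotprodC v u); ring.
    by rewrite -/(dotprod w u) wu /b invf_div ww; field.
  rewrite mul_mx_scalar scalerA mulrN divff ?scaleN1r ?opprK /w ?subrKC//.
  by rewrite mulf_neq0 ?invr_neq0// pnatr_eq0.
Qed.

(** Deflation: a Householder reflection sends the first basis vector to a top eigenvector. In the
    reflected basis the symmetric matrix splits into the eigenvalue and a smaller block, to which
    induction applies. *)
Lemma sym_spectral n (A : 'M[R]_n) : A^T = A -> exists (U : 'M[R]_n) d,
  U^T *m U = 1%:M /\ U^T *m A *m U = diag_mx d.
Proof.
elim: n A => [|n IH] A sA.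
  by exists 1%:M, 0; split; apply/matrixP => -[].
have [v v1 vmax] := rayleigh_max A.
have Av := rayleigh_eigenvector sA v1 vmax.
set l := qform A v in Av.
pose e0 : 'cV[R]_(1 + n) := col_mx 1%:M 0.
have [|H [sH HH He0]] := @householder _ e0 v.
  by rewrite v1 /dotprod tr_col_mx mul_row_col trmx1 mul1mx trmx0 mul0mx addr0 mxE eqxx.
pose B : 'M[R]_(1 + n) := H *m A *m H.
have sB : B^T = B by rewrite /B !trmx_mul sA sH mulmxA.
have Be0 : B *m e0 = l *: e0.
  by rewrite /B -!mulmxA He0 Av -scalemxAr -He0 mulmxA HH mul1mx.
have BE : B = block_mx l%:M 0 0 (drsubmx B).
  move: Be0; rewrite -{1}(submxK B) mul_block_col !mulmx0 !mulmx1 !addr0.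
  rewrite scale_col_mx scaler0 scalemx1 => /eq_col_mx[ulB dlB].
  rewrite -{1}(submxK B) ulB dlB; congr (block_mx _ _ _ _).
  by rewrite -[ursubmx B]trmxK trmx_ursub sB dlB trmx0.
have [|U [d [UU UB]]] := IH (drsubmx B); first by rewrite trmx_drsub sB.
pose V : 'M[R]_(1 + n) := block_mx 1%:M 0 0 U.
pose dV : 'rV[R]_(1 + n) := row_mx l%:M d.
have VV : V^T *m V = 1%:M.
  rewrite /V tr_block_mx mulmx_block !trmx0 !mulmx0 !mul0mx !addr0 !add0r.
  by rewrite trmx1 mulmx1 UU -scalar_mx_block.
have VB : V^T *m B *m V = diag_mx dV.
  rewrite BE /V tr_block_mx !mulmx_block !trmx0 !mulmx0 !mul0mx !addr0 !add0r.
  rewrite trmx1 mulmx1 mul1mx UB /dV diag_mx_row.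
  congr (block_mx _ _ _ _); rewrite ?mul0mx//.
  by apply/matrixP => i j; rewrite !ord1 !mxE.
exists (H *m V), dV; split.
  by rewrite trmx_mul sH mulmxA -(mulmxA V^T) HH mulmx1.
by rewrite trmx_mul sH -VB /B !mulmxA.
Qed.

End QuadraticForms.

(** * Separation *)

Section Separation.
Variable R : realType.

Lemma closure_sub_closed (X : topologicalType) (A B : set X) :
  closed B -> A `<=` B -> closure A `<=` B.
Proof. by move=> /closure_id {2}-> /closureS. Qed.

(** First-order condition at an endpoint of a segment. If [b < 0], then a = -b / (c - b) lies in (0,
    1] and gives the value a (b + a b) < 0. *)
Lemma linear_coef_ge0 (b c : R) : 0 <= c ->
  (forall a, 0 <= a <= 1 -> 0 <= 2 * a * b + a ^+ 2 * c) -> 0 <= b.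
Proof.
move=> c0 h; rewrite leNgt; apply/negP => b0.
have cb : 0 < c - b by lra.
pose a := - b / (c - b).
have a0 : 0 < a by rewrite divr_gt0// oppr_gt0.
have acb : a * (c - b) = - b by rewrite /a divfK// gt_eqF.
have a1 : a <= 1 by rewrite ler_pdivrMr//; lra.
have /h : 0 <= a <= 1 by rewrite (ltW a0).
suff : 2 * a * b + a ^+ 2 * c < 0 by lra.
by rewrite (_ : _ + _ = a * (2 * b + a * c)) ?pmulr_rlt0//; [nra|ring].
Qed.

(* The separating direction is the point of the closure closest to 0. *)
Lemma separation n (D : set 'cV[R]_n) d : 0 < d -> D !=set0 ->
  (forall x y a, D x -> D y -> 0 <= a <= 1 -> D (a *: x + (1 - a) *: y)) ->
  (forall z, D z -> d <= dotprod z z) ->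
  exists p, forall z, D z -> 0 < dotprod p z.
Proof.
move=> d0 [z0 Dz0] convD Dd.
have cst1 c : continuous (fun _ : 'cV[R]_n => (c : R)).
  by move=> x; exact: cst_continuous.
have cq := @continuous_qform R n 1%:M.
set M := dotprod z0 z0.
(* Cutting the closure at the norm of [z0] makes it compact and keeps its point nearest to 0. *)
pose A := closure D `&` [set z | qform 1%:M z <= M].
have A0 : A !=set0.
  by exists z0; split; [exact: subset_closure|rewrite /= qform1].
have cA : compact A.
  apply: (@bounded_closed_compact_cV _ _ _ (1 + M)).
    by apply: closedI; [exact: closed_closure|exact: closed_le_preimage].
  move=> x [_ /=]; rewrite qform1 => xM i; have M0 := dotprod_ge0 z0.
  rewrite -(@ler_pXn2r _ 2) ?nnegrE// ?addr_ge0// real_normK ?num_real//.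
  rewrite (le_trans (sqr_coord_le_dotprod x i))// (le_trans xM)// -/M.
  by move: M0; rewrite -/M; nra.
have [p] := compact_EVT_min A0 cA (continuous_subspaceT cq).
rewrite inE => -[Dp /=]; rewrite qform1 => pM pmin.
have pmin' y : closure D y -> dotprod p p <= dotprod y y.
  move=> Dy; have [yM|/ltW My] := leP (dotprod y y) M; last exact: le_trans My.
  by have := pmin y; rewrite inE !qform1; apply; split => //=; rewrite qform1.
exists p => z Dz.
have pp : d <= dotprod p p.
  rewrite -qform1.
  apply: (closure_sub_closed (closed_le_preimage (cst1 d) cq)) Dp => y /Dd.
  by rewrite /= qform1.
(* This is first-order optimality of [p]. It gives p.z >= p.p >= d > 0. *)
have : 0 <= dotprod (z - p) p; last first.
  by rewrite dotprodC dotprodBr subr_ge0 => /(le_trans pp)/(lt_le_trans d0).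
apply: (@linear_coef_ge0 _ (dotprod (z - p) (z - p))); first exact: dotprod_ge0.
move=> a a01; have := pmin' (p + a *: (z - p)).
rewrite -[leRHS]qform1 qform_addZ ?trmx1// mul1mx !qform1 -addrA lerDl; apply.
rewrite scalerBr addrCA -[X in _ + (X - _)]scale1r -scalerBl.
(* For fixed [z] in [D], this map sends [D] into itself, hence its closure into its closure; it is
   applied at [p]. *)
have cf : continuous (fun y : 'cV[R]_n => a *: z + (1 - a) *: y).
  apply: continuous_mx => i j.
  rewrite (_ : (fun x => _) = fun x : 'cV[R]_n => a * z i j + (1 - a) * x i j).
    move=> x; have Fx := nbhs_filter x; apply: cvgD; first exact: cvg_cst.
    by apply: cvgM; [exact: cvg_cst|exact: coord_continuous].
  by apply/funext => x; rewrite !mxE.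
have := (continuous_closedP _).1 cf _ (@closed_closure _ D).
move/closure_sub_closed => /(_ D); apply=> // y Dy /=.
by apply: subset_closure; exact: convD.
Qed.

End Separation.

(** * Strong duality *)

Section TraceForm.
Variable R : realType.

(** This is tr(A V V^T), where V V^T stands for the positive semidefinite variable of the dual. The
    factor [V] is what the rounding uses, and a free number of columns allows sums of such variables
    by concatenation. *)
Definition trform n N (A : 'M[R]_n) (V : 'M[R]_(n, N)) : R :=
  \tr (V^T *m A *m V).

Lemma trform_col n (A : 'M[R]_n) (x : 'cV[R]_n) : trform A x = qform A x.
Proof. exact: trace_mx11. Qed.

Lemma trformZ n N (A : 'M[R]_n) a (V : 'M[R]_(n, N)) :
  trform A (a *: V) = a ^+ 2 * trform A V.
Proof.
rewrite /trform -scalemxAr mxtraceZ linearZ/= -!scalemxAl mxtraceZ mulrA.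
by rewrite expr2.
Qed.

Lemma trform_row n N N' (A : 'M[R]_n) (V : 'M[R]_(n, N)) (W : 'M[R]_(n, N')) :
  trform A (row_mx V W) = trform A V + trform A W.
Proof.
by rewrite /trform tr_row_mx mul_col_mx mul_col_row mxtrace_block.
Qed.

End TraceForm.

Section StrongDuality.
Variables (R : realType) (m K : nat).
Variables (Q : 'M[R]_m) (S : 'I_K -> 'M[R]_m) (T : set 'cV[R]_K).
Hypothesis data : ellitope_data S T.

Lemma ell_conv x y a : T x -> T y -> 0 <= a <= 1 -> T (a *: x + (1 - a) *: y).
Proof.
move=> Tx Ty /andP[a0 a1].
have := ell_convex data (x := x) (y := y) (Itv01 a0 a1).
by rewrite !inE; apply.
Qed.

(** A strictly feasible point for the duality: lowering all coordinates of an interior point by half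
    the radius of a ball stays in the orthant. *)
Lemma ell_interior_lb :
  exists t c, [/\ T t, 0 < c & forall k, c <= t k 0].
Proof.
have [t [Tt]] := ell_interior data; rewrite /interior /=.
move=> /nbhs_ballP[e /= e0 te]; exists t, (e / 2); split=> // [|k].
  by rewrite divr_gt0.
have /te/(_ k) : ball t e (t - const_mx (e / 2)).
  split=> // i j; rewrite !mxE /ball/= opprB addrC subrK ger0_norm; lra.
by rewrite !mxE subr_ge0.
Qed.

(** The set [D] consists of the upper bounds of objective deficits and constraint violations. A
    vector [p] separating it from 0 is nonnegative because [D] is upward closed, and its first entry
    is positive by strict feasibility. Dividing the other entries by it gives the multipliers. *)
Lemma strong_duality r r' : Q^T = Q -> 
  (forall N (V : 'M[R]_(m, N)) t, T t -> (forall k, trform (S k) V <= t k 0) ->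
    trform Q V <= r) ->
  r < r' ->
  exists2 l : 'cV[R]_K, (forall k, 0 <= l k 0) /\ lemx Q (\sum_k l k 0 *: S k) &
    forall t, T t -> dotprod l t <= r'.
Proof.
move=> sQ dual rr'.
have [t0 [c [Tt0 c0 t0c]]] := ell_interior_lb.
have tf0 (A : 'M[R]_m) : trform A (0 : 'cV[R]_m) = 0.
  by rewrite trform_col /qform mulmx0 mxE.
have r0 : 0 <= r.
  rewrite -(tf0 Q); apply: (dual _ _ t0) => // k.
  by rewrite tf0 (le_trans _ (t0c k))// ltW.
have cr : 0 < c + r by lra.
(* Chosen so that a (r' - d) = r for the scaling a = c / (c + d) used below. *)
pose d := c * (r' - r) / (c + r).
have d0 : 0 < d by rewrite divr_gt0// mulr_gt0// subr_gt0.
have dE : d * (c + r) = c * (r' - r) by rewrite /d divfK// gt_eqF.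
pose D : set 'cV[R]_K.+1 := [set z | exists N (V : 'M[R]_(m, N)) t,
  [/\ T t, forall k, trform (S k) V - t k 0 <= z (lift ord0 k) 0 &
      r' - trform Q V <= z ord0 0]].
have upD (z w : 'cV[R]_K.+1) : D z -> (forall i, z i 0 <= w i 0) -> D w.
  move=> [N [V [t [Tt zS zQ]]]] zw; exists N, V, t; split=> // [k|].
    exact: le_trans (zS k) _.
  exact: le_trans zQ _.
have Dd z : D z -> exists i, d <= z i 0.
  move=> [N [V [t [Tt zS zQ]]]]; apply: contrapT => /forallNP zd.
  have {}zd i : z i 0 < d by rewrite ltNge; apply/negP/zd.
  have cd : 0 < c + d by lra.
  pose a := c / (c + d).
  have a0 : 0 < a by rewrite divr_gt0.
  have acd : a * (c + d) = c by rewrite /a divfK// gt_eqF.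
  have a1 : a <= 1 by rewrite ler_pdivrMr//; lra.
  (* Mixing [t] with [t0] creates the slack (1 - a) c = a d, which absorbs the scaled violations.
     The square root appears because [trform] is quadratic in [V]. *)
  have aQ : trform Q (Num.sqrt a *: V) <= r.
    apply: (dual _ _ (a *: t + (1 - a) *: t0)) => [|k].
      by apply: ell_conv; rewrite // (ltW a0).
    rewrite trformZ sqr_sqrtr ?(ltW a0)// !mxE.
    have := zS k; have := zd (lift ord0 k); have := t0c k.
    by nra.
  rewrite trformZ sqr_sqrtr ?(ltW a0)// in aQ.
  by have := zd ord0; nra.
pose Z N (V : 'M[R]_(m, N)) (t : 'cV[R]_K) : 'cV[R]_K.+1 := \col_i
  (if unlift ord0 i is Some k then trform (S k) V - t k 0 else r' - trform Q V).
have DZ N (V : 'M[R]_(m, N)) t : T t -> D (Z N V t).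
  by move=> Tt; exists N, V, t; split=> // [k|]; rewrite mxE ?liftK ?unlift_none.
have [||||p pD] := @separation _ _ D (d ^+ 2).
- by rewrite exprn_gt0.
- by exists (Z 1 0 t0); exact: DZ.
- move=> x y a [N [V [t [Tt xS xQ]]]] [N' [V' [t' [Tt' yS yQ]]]] /[dup] a01 /andP[a0 a1].
  exists (N + N')%N, (row_mx (Num.sqrt a *: V) (Num.sqrt (1 - a) *: V')).
  exists (a *: t + (1 - a) *: t'); split=> [|k|]; first exact: ell_conv.
    rewrite trform_row !trformZ !sqr_sqrtr ?subr_ge0// !mxE.
    have := xS k; have := yS k; nra.
  rewrite trform_row !trformZ !sqr_sqrtr ?subr_ge0// !mxE.
  by nra.
- move=> z /Dd[i zi]; apply: le_trans (sqr_coord_le_dotprod z i).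
  by rewrite ler_pXn2r// ?nnegrE ?(ltW d0)// (le_trans (ltW d0)).
(* If [p i 0 < 0], raising coordinate [i] of a point of [D] far enough brings its product with [p]
   to 0 without leaving [D]. *)
have p0 i : 0 <= p i 0.
  rewrite leNgt; apply/negP => pi.
  have pz := pD _ (DZ 1 0 _ Tt0).
  set z := Z 1 0 t0 in pz.
  have s0 : 0 <= - (dotprod p z / p i 0).
    by rewrite oppr_ge0 pmulr_rle0// invr_le0 ltW.
  have /pD : D (z + - (dotprod p z / p i 0) *: delta_mx i 0).
    apply: (upD z) => [|j]; first exact: DZ.
    by rewrite !mxE lerDl mulr_ge0.
  rewrite dotprodDr dotprodZr (_ : dotprod p (delta_mx i 0) = p i 0).
    by rewrite mulNr divfK ?lt_eqF// subrr ltxx.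
  rewrite dotprodE (bigD1 i)//= mxE !eqxx mulr1 big1 ?addr0// => j ji.
  by rewrite mxE (negbTE ji) mulr0.
pose q k := p (lift ord0 k) 0.
have key N (V : 'M[R]_(m, N)) t : T t ->
    0 < p ord0 0 * (r' - trform Q V) + \sum_k q k * (trform (S k) V - t k 0).
  move=> /DZ -/(_ N V)/pD; rewrite dotprodE big_ord_recl mxE unlift_none.
  by under eq_bigr do rewrite mxE liftK.
have key0 t : T t -> 0 < p ord0 0 * r' - \sum_k q k * t k 0.
  move=> /(key 1 0); rewrite tf0 subr0 -sumrN.
  by under eq_bigr do rewrite tf0 sub0r mulrN.
have pp : 0 < p ord0 0.
  rewrite lt_neqAle eq_sym p0 andbT; apply/eqP => p00.
  have := key0 _ Tt0; rewrite p00 mul0r sub0r oppr_gt0 ltNge sumr_ge0// => k _.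
  by rewrite mulr_ge0 ?p0// (le_trans (ltW c0)).
exists (\col_k (q k / p ord0 0)).
  split=> [k|]; first by rewrite mxE divr_ge0 ?p0.
  split=> [|x].
    rewrite linearB/= sQ linear_sum/=; congr (_ - _); apply: eq_bigr => k _.
    by rewrite linearZ/= (ell_psd data k).1.
  rewrite qformBl qform_suml subr_ge0.
  under eq_bigr do rewrite qformZl mxE mulrAC.
  rewrite -mulr_suml ler_pdivlMr// leNgt; apply/negP => B0.
  (* If the Loewner inequality failed at [x], scaling [x] by the square root of [A / B] would make
     the positive quantity of [key] exactly 0. *)
  pose B := qform Q x * p ord0 0 - \sum_k q k * qform (S k) x.
  pose A := p ord0 0 * r' - \sum_k q k * t0 k 0.
  have {}B0 : 0 < B by rewrite subr_gt0.
  have A0 : 0 < A := key0 _ Tt0.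
  have := key 1 (Num.sqrt (A / B) *: x) t0 Tt0.
  rewrite trformZ trform_col sqr_sqrtr ?divr_ge0 ?ltW//.
  under eq_bigr do rewrite trformZ trform_col sqr_sqrtr ?divr_ge0 ?ltW// mulrBr mulrCA.
  rewrite sumrB -mulr_sumr.
  rewrite (_ : _ + _ = A - A / B * B); last by rewrite /A /B; ring.
  by rewrite divfK ?gt_eqF// subrr ltxx.
move=> t Tt; rewrite dotprodE; under eq_bigr do rewrite mxE mulrAC.
by rewrite -mulr_suml ler_pdivrMr// mulrC -subr_ge0 ltW// key0.
Qed.

End StrongDuality.

(** * Rounding *)

Section Rounding.
Variable R : realType.

Lemma qform_diag n (d : 'rV[R]_n) x :
  qform (diag_mx d) x = \sum_i d 0 i * x i 0 ^+ 2.
Proof.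
rewrite qformE; apply: eq_bigr => i _; rewrite (bigD1 i)//= mxE eqxx mulr1n.
rewrite big1 ?addr0 -?expr2// => j ji.
by rewrite mxE eq_sym (negbTE ji) mulr0n mul0r.
Qed.

(** The [u l] are the columns of a diagonalizing orthogonal matrix and the [d l] the eigenvalues,
    which serve as weights for Jensen's inequality. *)
Lemma sym_qform_squares n (A : 'M[R]_n) : A^T = A ->
  exists (u : 'I_n -> 'I_n -> R) (d : 'I_n -> R),
  [/\ forall l, \sum_i u l i ^+ 2 = 1, \sum_l d l = \tr A,
      forall x, qform A x = \sum_l d l * (\sum_i u l i * x i 0) ^+ 2
    & psdmx A -> forall l, 0 <= d l].
Proof.
move=> sA; have [U [d [UU UA]]] := sym_spectral sA.
have UU' := mulmx1C UU.
exists (fun l i => U i l), (fun l => d 0 l); split=> [l||x|[_ A0] l].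
- have /matrixP/(_ l l) := UU; rewrite !mxE eqxx => h.
  by apply: etrans h; apply: eq_bigr => i _; rewrite mxE expr2.
- by rewrite -mxtrace_diag -UA mxtrace_mulC mulmxA UU' mul1mx.
- rewrite -[in LHS](mul1mx x) -UU' -mulmxA qform_mulmx UA qform_diag.
  by apply: eq_bigr => l _; rewrite mxE; under eq_bigr do rewrite mxE.
- suff <- : qform A (U *m delta_mx l 0) = d 0 l by [].
  rewrite qform_mulmx UA qform_diag (bigD1 l)//= mxE !eqxx expr1n mulr1.
  by rewrite big1 ?addr0// => i il; rewrite mxE (negbTE il) expr0n mulr0.
Qed.

Lemma trform_mul_orth n N (A : 'M[R]_n) (V : 'M[R]_(n, N)) (U : 'M[R]_N) :
  U^T *m U = 1%:M -> trform A (V *m U) = trform A V.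
Proof.
move=> /mulmx1C UU; rewrite /trform trmx_mul !mulmxA mxtrace_mulC.
by rewrite !mulmxA UU mul1mx.
Qed.

Lemma psdmx_conj n N (A : 'M[R]_n) (V : 'M[R]_(n, N)) :
  psdmx A -> psdmx (V^T *m A *m V).
Proof.
move=> [sA A0]; split=> [|x]; last by rewrite -qform_mulmx.
by rewrite !trmx_mul trmxK sA mulmxA.
Qed.

(** This is y <= sinh y for y = ln(1 + 2u). It bounds the Gaussian factor (1 - 2 th)^(-1/2) = sqrt(1
    + 2u) by exp(th (1 + u)), where th = u / (1 + 2u). *)
Lemma sqrt_le_expR (u : R) : 0 < u ->
  Num.sqrt (1 + 2 * u) <= expR (u * (1 + u) / (1 + 2 * u)).
Proof.
move=> u0; set c := _ / _; have z0 : 0 < 1 + 2 * u by lra.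
rewrite -(@ler_pXn2r _ 2) ?nnegrE ?sqrtr_ge0 ?expR_ge0// sqr_sqrtr ?(ltW z0)//.
rewrite -expRM_natl -{1}(lnK z0) ler_expR.
have := @two_mul_le_expRB R (ln (1 + 2 * u)).
rewrite ln_ge0 ?expRN ?lnK//; last by lra.
move=> /(_ isT); rewrite (_ : _ - _ = 2 * (2 * c)) ?ler_pM2l//.
by rewrite /c; field; rewrite gt_eqF.
Qed.

(* [e] is a vector of signs and [V *m U *m e] the rounded point: [U]
   diagonalizes the objective, whose value is then the same for all signs. *)
Lemma rounding m N K (Q : 'M[R]_m) (S : 'I_K -> 'M[R]_m) (V : 'M[R]_(m, N)) u :
  (0 < K)%N -> Q^T = Q -> (forall k, psdmx (S k)) -> 0 < u ->
  exists2 y, qform Q y = trform Q V & forall k, qform (S k) y <=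
    (1 + 2 * ln K%:R + ln K%:R / u + u) * trform (S k) V.
Proof.
move=> K0 sQ psdS u0.
have sM : (V^T *m Q *m V)^T = V^T *m Q *m V by rewrite !trmx_mul trmxK sQ mulmxA.
have [U [d [UU UM]]] := sym_spectral sM.
pose W := V *m U.
pose tau k := trform (S k) V.
have [a /fin_all_exists[g ag]] := fin_all_exists
  (fun k => sym_qform_squares (psdmx_conj W (psdS k)).1).
have a1 k l : \sum_i a k l i ^+ 2 = 1 by case: (ag k).
have gtau k : \sum_l g k l = tau k.
  by case: (ag k) => _ -> _ _; rewrite -/(trform _ _) trform_mul_orth.
have gE k x : qform (S k) (W *m x) =
    \sum_l g k l * (\sum_i a k l i * x i 0) ^+ 2.
  by rewrite qform_mulmx; case: (ag k).
have g0 k l : 0 <= g k l by case: (ag k) => _ _ _; apply; exact: psdmx_conj.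
have tau0 k : 0 <= tau k by rewrite -gtau sumr_ge0.
pose theta := u / (1 + 2 * u).
have z0 : 0 < 1 + 2 * u by lra.
have theta0 : 0 < theta by rewrite divr_gt0.
have thetaE : 1 - 2 * theta * 1 = (1 + 2 * u)^-1.
  by rewrite /theta; field; rewrite gt_eqF.
(* For each [k] these weights sum to 1, or to 0 if [tau k = 0] since division by 0 gives 0. Their
   total is at most [K]. *)
pose w (j : 'I_K * 'I_N) := g j.1 j.2 / tau j.1.
have w0 j : 0 <= w j by rewrite divr_ge0.
have [|e e1 He] := exists_signs_expR_le (fun=> 0) (u := fun j => a j.1 j.2)
    w0 (ltW theta0).
  by move=> j; rewrite a1 thetaE invr_gt0.
pose y := W *m \col_i e i.
have sE k l : \sum_i a k l i * (\col_i e i) i 0 = \sum_i a k l i * e i.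
  by apply: eq_bigr => i _; rewrite mxE.
have total : \sum_j w j * expR (theta * (\sum_i a j.1 j.2 i * e i) ^+ 2) <=
    K%:R * expR (theta * (1 + u)).
  under eq_bigr do rewrite -[X in X ^+ 2]add0r.
  apply: (le_trans He).
  under eq_bigr do rewrite a1 thetaE expr0n/= mulr0 mul0r expR0 mulr1.
  rewrite -mulr_suml sqrtrV ?(ltW z0)// invrK ler_pM ?sqrtr_ge0 ?sumr_ge0//.
    rewrite -(pair_bigA _ (fun k l => g k l / tau k))/=.
    rewrite -[K in leRHS]card_ord -sumr_const.
    apply: ler_sum => k _; rewrite -mulr_suml gtau.
    have [->|tk] := eqVneq (tau k) 0; first by rewrite mul0r.
    by rewrite divff.
  rewrite (_ : theta * (1 + u) = u * (1 + u) / (1 + 2 * u)) ?sqrt_le_expR//.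
  by rewrite /theta mulrAC.
exists y => [|k].
  rewrite /y /W -mulmxA qform_mulmx qform_mulmx UM qform_diag.
  under eq_bigr do rewrite mxE e1 mulr1.
  by rewrite -mxtrace_diag -UM -(trform_mul_orth Q V UU) /trform trmx_mul !mulmxA.
rewrite -/(tau k) gE; under eq_bigr do rewrite sE.
(* A zero trace forces all the eigenvalues [g k l] to vanish, and the form with them. *)
have [tk|tk] := eqVneq (tau k) 0.
  rewrite tk mulr0 big1// => l _; apply/eqP; rewrite mulf_eq0; apply/orP; left.
  by have /eqP := gtau k; rewrite tk psumr_eq0// => /allP; apply; rewrite mem_index_enum.
have tk0 : 0 < tau k by rewrite lt_neqAle eq_sym tk tau0.
set q := \sum_l _; rewrite -ler_pdivrMr//.
(* The terms of the single index [k] are bounded by [total]; Jensen's inequality bounds them below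
   by one exponential, and a logarithm concludes. *)
have : theta * (q / tau k) <= ln K%:R + theta * (1 + u).
  rewrite -ler_expR expRD lnK ?posrE ?ltr0n//; apply: le_trans total.
  rewrite -(pair_bigA _ (fun k l => g k l / tau k *
    expR (theta * (\sum_i a k l i * e i) ^+ 2)))/=.
  rewrite (bigD1 k)//= -[leLHS]addr0 lerD//; last first.
    by do 2 apply: sumr_ge0 => ? _; rewrite mulr_ge0 ?expR_ge0 ?divr_ge0.
  rewrite (_ : theta * _ = \sum_l g k l / tau k * (theta * (\sum_i a k l i * e i) ^+ 2)).
    apply: (@expR_jensen _ _ (fun l => g k l / tau k)
      (fun l => theta * (\sum_i a k l i * e i) ^+ 2)) => [l|].
      by rewrite divr_ge0.
    by rewrite -mulr_suml gtau divff.
  by rewrite /q mulr_suml mulr_sumr; apply: eq_bigr => l _; ring.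
(* Since 1 / th = 2 + 1 / u, dividing by [theta] yields exactly the announced constant. *)
rewrite -(ler_pdivlMl _ _ theta0) => /le_trans; apply.
rewrite le_eqVlt; apply/orP; left; apply/eqP.
by rewrite /theta; field; rewrite !gt_eqF.
Qed.

End Rounding.

(** * Attainment and comparison of the optimal values *)

Section Attainment.
Variables (R : realType) (n nbar K : nat).
Variables (C : 'M[R]_n) (P : 'M[R]_(n, nbar)).
Variables (S : 'I_K -> 'M[R]_nbar) (T : set 'cV[R]_K).
Hypotheses (C_sym : C^T = C) (data : ellitope_data S T).

Let Q := P^T *m C *m P.

Lemma is_max_sup (A : set R) m : is_max A m -> is_max A (sup A).
Proof.
move=> [Am ub]; suff -> : sup A = m by [].
apply/eqP; rewrite eq_le ge_sup//=; last by exists m.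
by apply: ub_le_sup => //; exists m.
Qed.

Lemma is_min_inf (A : set R) m : is_min A m -> is_min A (inf A).
Proof.
move=> [Am lb]; suff -> : inf A = m by [].
apply/eqP; rewrite eq_le lb_le_inf ?andbT//=; last by exists m.
by apply: ge_inf => //; exists m.
Qed.

Lemma trQ : Q^T = Q.
Proof. by rewrite /Q !trmx_mul trmxK C_sym mulmxA. Qed.

Lemma ge_support_fun (l t : 'cV[R]_K) : T t -> dotprod l t <= support_fun T l.
Proof.
move=> Tt; have [_ ub] := support_fun_max l (ell_nonempty data) (ell_compact data).
by apply: ub; exists t.
Qed.

Lemma support_fun_le (l : 'cV[R]_K) r :
  (forall t, T t -> dotprod l t <= r) -> support_fun T l <= r.
Proof.
have [[t Tt <-] _] := support_fun_max l (ell_nonempty data) (ell_compact data).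
exact.
Qed.

(** Monotonicity of [T] allows [t] to be lowered to the vector of the y^T S_k y, leaving [y] as the
    only variable. *)
Lemma ellitopeE x : ellitope P S T x <->
  exists2 y, T (\col_k qform (S k) y) & x = P *m y.
Proof.
split=> [[y [t [Tt -> yt]]]|[y Ty ->]].
  exists y => //; apply: (ell_monotone data Tt) => k.
  by rewrite mxE; split=> //; exact: (ell_psd data k).2.
by exists y, (\col_k qform (S k) y); split=> // k; rewrite mxE.
Qed.

(** Definiteness of the sum of the S_k gives c |y|^2 <= b, where [b] is the maximal coordinate sum
    over [T]. The bound 1 + b / c on the coordinates avoids a square root. *)
Lemma compact_ell_preimage : compact [set y | T (\col_k qform (S k) y)].
Proof.
have [c c0 cS] := pdmx_qform_lb (ell_pd data).
pose b := support_fun T (const_mx 1).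
apply: (@bounded_closed_compact_cV _ _ _ (1 + b / c)).
  have cf : continuous (fun y => \col_k qform (S k) y).
    apply: continuous_mx => k j.
    rewrite (_ : (fun y => _) = qform (S k)); first exact: continuous_qform.
    by apply/funext => y; rewrite mxE.
  apply: (continuous_closedP _).1 cf _ _.
  by apply: compact_closed_cV; exact: ell_compact data.
move=> y /= Ty i.
have yb : dotprod y y <= b / c.
  rewrite ler_pdivlMr// mulrC (le_trans (cS y))// qform_suml.
  rewrite (le_trans _ (ge_support_fun (const_mx 1) Ty))// dotprodE.
  by apply: ler_sum => k _; rewrite !mxE mul1r.
have b0 : 0 <= b / c := le_trans (dotprod_ge0 y) yb.
rewrite -(@ler_pXn2r _ 2) ?nnegrE// ?addr_ge0// real_normK ?num_real//.
rewrite (le_trans (sqr_coord_le_dotprod y i))// (le_trans yb)//; nra.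
Qed.

Lemma Opt_star_max : is_max (primal_values C P S T) (Opt_star C P S T).
Proof.
have [t Tt] := ell_nonempty data.
have T0 : [set y | T (\col_k qform (S k) y)] !=set0.
  exists 0; apply: (ell_monotone data Tt) => k.
  by rewrite mxE /qform mulmx0 mxE; split=> //; exact: ell_orthant data _ Tt _.
have [y] := compact_EVT_max T0 compact_ell_preimage
  (continuous_subspaceT (@continuous_qform _ _ Q)).
rewrite inE/= => Ty ymax.
apply: (@is_max_sup _ (qform Q y)); split.
  by exists (P *m y); [apply/ellitopeE; exists y|rewrite qform_mulmx].
move=> _ [_ /ellitopeE[y' Ty' ->] <-].
by rewrite qform_mulmx ymax// inE.
Qed.

Lemma lemx_sumP (l : 'cV[R]_K) : lemx Q (\sum_k l k 0 *: S k) <->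
  forall x, qform Q x <= \sum_k l k 0 * qform (S k) x.
Proof.
have E x : qform (\sum_k l k 0 *: S k - Q) x =
    \sum_k l k 0 * qform (S k) x - qform Q x.
  by rewrite qformBl qform_suml; under eq_bigr do rewrite qformZl.
split=> [[_ h] x|h]; first by rewrite -subr_ge0 -E.
split=> [|x]; last by rewrite E subr_ge0.
rewrite linearB/= trQ linear_sum/=; congr (_ - _); apply: eq_bigr => k _.
by rewrite linearZ/= (ell_psd data k).1.
Qed.

(** Equal multipliers work: Q is below M I, which is below M / c times the sum of the S_k. *)
Lemma relax_feasible_neq0 : relax_feasible C P S !=set0.
Proof.
have [M M0 QM] := qform_ub Q.
have [c c0 cS] := pdmx_qform_lb (ell_pd data).
exists (const_mx (M / c)); split=> [k|]; first by rewrite mxE divr_ge0// ltW.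
apply/lemx_sumP => x; under eq_bigr do rewrite mxE.
rewrite -mulr_sumr -qform_suml (le_trans (QM x))// -mulrA ler_wpM2l//.
by rewrite ler_pdivlMl.
Qed.

(* The support function is minimized through its epigraph: coordinate [ord0]
   of [z] bounds the support function at the remaining coordinates. *)
Lemma Opt_min : is_min (relax_values C P S T) (Opt C P S T).
Proof.
have [l0 l0F] := relax_feasible_neq0.
have [t0 [c [Tt0 c0 t0c]]] := ell_interior_lb data.
pose s0 := support_fun T l0.
pose lam (z : 'cV[R]_K.+1) : 'cV[R]_K := \col_k z (lift ord0 k) 0.
(* The cap [s0], the value at a known feasible point, makes this part of the epigraph bounded. *)
pose E := [set z : 'cV[R]_K.+1 | [/\ z ord0 0 <= s0,
  forall k, 0 <= lam z k 0,
  forall x, qform Q x <= \sum_k lam z k 0 * qform (S k) x &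
  forall t, T t -> \sum_k lam z k 0 * t k 0 <= z ord0 0]].
have clam (a : 'I_K -> R) : continuous (fun z => \sum_k lam z k 0 * a k).
  apply: continuous_sum => k.
  rewrite (_ : (fun z => _) = fun z : 'cV[R]_K.+1 => z (lift ord0 k) 0 * a k).
    move=> z; have Fz := nbhs_filter z.
    by apply: cvgM; [exact: coord_continuous|exact: cvg_cst].
  by apply/funext => z; rewrite mxE.
have clam1 k : continuous (fun z => lam z k 0).
  rewrite (_ : (fun z => _) = fun z : 'cV[R]_K.+1 => z (lift ord0 k) 0).
    by move=> z; exact: coord_continuous.
  by apply/funext => z; rewrite mxE.
have cst1 a : continuous (fun _ : 'cV[R]_K.+1 => (a : R)).
  by move=> z; exact: cst_continuous.
have c00 : continuous (fun z : 'cV[R]_K.+1 => z ord0 0).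
  by move=> z; exact: coord_continuous.
have clE : closed E.
  rewrite (_ : E = [set z : 'cV[R]_K.+1 | z ord0 0 <= s0] `&`
    (\bigcap_(k in setT) [set z | 0 <= lam z k 0] `&`
    (\bigcap_(x in setT) [set z | qform Q x <= \sum_k lam z k 0 * qform (S k) x] `&`
     \bigcap_(t in T) [set z | \sum_k lam z k 0 * t k 0 <= z ord0 0]))).
    apply: closedI; first exact: closed_le_preimage.
    apply: closedI.
      by apply: closed_bigI => k _; exact: closed_le_preimage.
    apply: closedI.
      by apply: closed_bigI => x _; exact: closed_le_preimage.
    by apply: closed_bigI => t _; exact: closed_le_preimage.
  apply/seteqP; split=> z.
    move=> [h1 h2 h3 h4]; split=> //; split=> [k _|]; first exact: h2.
    by split=> [x _|]; [exact: h3|exact: h4].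
  by move=> [h1 [h2 [h3 h4]]]; split=> // [k|x]; [exact: h2|exact: h3].
have cE : compact E.
  apply: (@bounded_closed_compact_cV _ _ _ (s0 + s0 / c)) => // z.
  move=> [zs z0 _ zT] i.
  (* Testing against [t0], whose coordinates are at least [c], bounds the sum of the multipliers by
     s0 / c. *)
  have sz : (\sum_k lam z k 0) * c <= z ord0 0.
    rewrite (le_trans _ (zT _ Tt0))// mulr_suml.
    by apply: ler_sum => k _; rewrite ler_wpM2l.
  have szge0 : 0 <= \sum_k lam z k 0 by rewrite sumr_ge0.
  have s0ge0 : 0 <= s0 by rewrite (le_trans _ zs)// (le_trans _ sz)// mulr_ge0// ltW.
  have sc0 : 0 <= s0 / c by rewrite divr_ge0// ltW.
  have [k ->|->] := unliftP ord0 i.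
    have : lam z k 0 <= s0 / c.
      rewrite ler_pdivlMr// (le_trans _ zs)// (le_trans _ sz)// ler_wpM2r ?(ltW c0)//.
      by rewrite (bigD1 k)//= lerDl sumr_ge0.
    by have := z0 k; rewrite mxE => zk zkc; rewrite ger0_norm// (le_trans zkc)// lerDr.
  rewrite ger0_norm; first by rewrite (le_trans zs)// lerDl.
  by rewrite (le_trans _ sz)// mulr_ge0// ltW.
pose epi (l : 'cV[R]_K) : 'cV[R]_K.+1 :=
  \col_i (if unlift ord0 i is Some k then l k 0 else support_fun T l).
have lamepi l : lam (epi l) = l.
  by apply/colP => k; rewrite !mxE liftK.
have epi0 l : epi l ord0 0 = support_fun T l by rewrite mxE unlift_none.
have epiE l : relax_feasible C P S l -> support_fun T l <= s0 -> E (epi l).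
  move=> [l_ge0 /lemx_sumP lQ] ls; split; rewrite ?lamepi ?epi0//.
  by move=> t Tt; rewrite -dotprodE ge_support_fun.
have E0 : E !=set0 by exists (epi l0); exact: epiE.
have [z] := compact_EVT_min E0 cE (continuous_subspaceT c00).
rewrite inE => -[zs z0 zQ zT] zmin.
have zF : relax_feasible C P S (lam z) by split=> //; exact/lemx_sumP.
have zsup : support_fun T (lam z) <= z ord0 0.
  by apply: support_fun_le => t Tt; rewrite dotprodE zT.
apply: (@is_min_inf _ (support_fun T (lam z))); split; first by exists (lam z).
move=> _ [l lF <-]; apply: (le_trans zsup).
(* Feasible multipliers of value above [s0] cannot improve on [z]. *)
have [ls|/ltW ls] := leP (support_fun T l) s0; last exact: le_trans zs ls.
by rewrite -epi0 zmin// inE; exact: epiE.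
Qed.

Lemma Opt_star_ge0 : 0 <= Opt_star C P S T.
Proof.
have [t Tt] := ell_nonempty data.
apply: (proj2 Opt_star_max); exists 0; last by rewrite /qform mulmx0 mxE.
exists 0, t; split=> // [|k]; first by rewrite mulmx0.
by rewrite /qform mulmx0 mxE; exact: ell_orthant data _ Tt _.
Qed.

Lemma Opt_star_le_Opt : Opt_star C P S T <= Opt C P S T.
Proof.
have [[x [y [t [Tt -> yt]]] <-] _] := Opt_star_max.
have [[l [l0 /lemx_sumP lQ] <-] _] := Opt_min.
rewrite qform_mulmx (le_trans (lQ y))//.
rewrite (le_trans _ (ge_support_fun l Tt))// dotprodE.
by apply: ler_sum => k _; rewrite ler_wpM2l.
Qed.

(** Rounding bounds the dual values by g times Opt_*. If that were below Opt, strong duality at the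
    midpoint would give a feasible multiplier of value below Opt. *)
Lemma Opt_le_mul_Opt_star u : (0 < K)%N -> 0 < u ->
  Opt C P S T <= (1 + 2 * ln K%:R + ln K%:R / u + u) * Opt_star C P S T.
Proof.
move=> K0 u0; set g := _ + u.
have g0 : 0 < g.
  have x0 : 0 <= ln K%:R :> R by rewrite ln_ge0// ler1n.
  have xu0 : 0 <= ln K%:R / u :> R by rewrite divr_ge0// ltW.
  by rewrite /g; lra.
rewrite leNgt; apply/negP => gOpt.
have /midf_lt[gm mOpt] := gOpt.
have [|l lF lT] := strong_duality data trQ _ gm.
  move=> N V t Tt VS.
  have [y yQ yS] := rounding V K0 trQ (ell_psd data) u0.
  rewrite -/g in yS; rewrite -yQ -ler_pdivrMl//.
  (* Dividing the rounded point by the square root of [g] restores the constraints for [t] and costs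
     the factor [g] in the objective. *)
  apply: (proj2 Opt_star_max); exists (P *m ((Num.sqrt g)^-1 *: y)).
    exists ((Num.sqrt g)^-1 *: y), t; split=> // k.
    rewrite qformZ exprVn sqr_sqrtr ?(ltW g0)// ler_pdivrMl//.
    by rewrite (le_trans (yS k))// ler_wpM2l// ltW.
  by rewrite qform_mulmx qformZ exprVn sqr_sqrtr// ltW.
have := proj2 Opt_min _ (ex_intro2 _ _ l lF erefl).
by rewrite leNgt (le_lt_trans (support_fun_le lT)).
Qed.

End Attainment.

Theorem proposition3p3 (R : realType) (n nbar K : nat)
    (C : 'M[R]_n) (P : 'M[R]_(n, nbar))
    (S : 'I_K -> 'M[R]_nbar) (T : set 'cV[R]_K)
    (K_gt0 : (0 < K)%N) (C_sym : C^T = C) (data : ellitope_data S T) :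
  [/\ is_max (primal_values C P S T) (Opt_star C P S T),
      is_min (relax_values C P S T) (Opt C P S T),
      Opt C P S T / (2 * ln K%:R + 2 * Num.sqrt (ln K%:R) + 1)
        <= Opt_star C P S T
    & Opt_star C P S T <= Opt C P S T].
Proof.
split; [exact: Opt_star_max|exact: Opt_min| |exact: Opt_star_le_Opt].
have bound u := Opt_le_mul_Opt_star P C_sym data (u := u) K_gt0.
have x0 : 0 <= ln K%:R :> R by rewrite ln_ge0// ler1n.
have s0 := sqrtr_ge0 (ln K%:R : R).
rewrite ler_pdivrMr; last by lra.
(* For ln K > 0, the choice u = sqrt(ln K) turns ln K / u + u into 2 sqrt(ln K). *)
have [x_eq0|x_neq0] := eqVneq (ln K%:R : R) 0; last first.
  have xp : 0 < ln K%:R :> R by rewrite lt_neqAle eq_sym x_neq0.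
  have sp : 0 < Num.sqrt (ln K%:R) :> R by rewrite sqrtr_gt0.
  apply: le_trans (bound _ sp) _.
  rewrite -[X in X / Num.sqrt _](sqr_sqrtr x0) expr2 mulfK ?gt_eqF//; lra.
(* Here the factor is 1 + u, and the [u] chosen below makes the excess u Opt_* at most [e]; adding 1
   in its denominator covers Opt_* = 0. *)
rewrite x_eq0 sqrtr0 !mulr0 !add0r mulr1; apply/ler_addgt0Pr => e e0.
have O0 := Opt_star_ge0 C P data.
have u0 : 0 < e / (Opt_star C P S T + 1) by rewrite divr_gt0// ltr_wpDl.
apply: le_trans (bound _ u0) _.
rewrite x_eq0 mulr0 mul0r !addr0 mulrDl mul1r lerD2l mulrAC.
rewrite ler_pdivrMr ?ltr_wpDl//; nra.
Qed.
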